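(* Suppose that $\mathcal A$ and $\mathcal B$ are infinite sets. For $\lambda\in\mathbb Z_+^n$ we have $$S^{\mathcal A/\mathcal B}_{\lambda}=\det\left(S^{\mathcal A/\mathcal B}_{\lambda_i-i+j}\right)_{1\le i,j\le n},$$ where in the determinant each integer $\lambda_i-i+j$ is regarded as a generalized partition of level $1$.
   Context: $\mathcal A=\mathcal A_0\sqcup\mathcal A_1$ and $\mathcal B=\mathcal B_0\sqcup\mathcal B_1$ are at most countable, linearly ordered, $\mathbb Z_2$-graded sets. $\mathscr P_n$ is the set of partitions of length at most $n$, identified with Young diagrams; $(d^n)=(d,\dots,d)$ ($n$ entries). For a skew Young diagram $\lambda/\mu$, $SST_{\mathcal A}(\lambda/\mu)$ is the set of $\mathcal A$-semistandard tableaux: fillings of $\lambda/\mu$ with entries in $\mathcal A$, weakly increasing along rows (left to right) and columns (top to bottom), with entries of $\mathcal A_0$ strictly increasing in each column and entries of $\mathcal A_1$ strictly increasing in each row. The empty shape has exactly one tableau $\emptyset$. $\mathbb Z_+^n=\{\lambda\in\mathbb Z^n: \lambda_1\geq\dots\geq\lambda_n\}$ (generalized partitions of level $n$; so $\mathbb Z_+^1=\mathbb Z$), with componentwise addition; $\mathscr P_n\subset\mathbb Z^n_+$. For $\lambda\in\mathbb Z_+^n$, $SST_{\mathcal A/\mathcal B}(\lambda)$ is the set of pairs $(T^+,T^-)$ with $T^+\in SST_{\mathcal A}((\lambda+(d^n))/\mu)$ and $T^-\in SST_{\mathcal B}((d^n)/\mu)$ for some integer $d\ge 0$ and $\mu\in\mathscr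 P_n$ such that $\lambda+(d^n)\in\mathscr P_n$, $\mu\subset(d^n)$ and $\mu\subset\lambda+(d^n)$. Diagrams are placed in $n$ rows with column positions measured from a vertical line after column $d$, so that pairs arising from $(d,\mu)$ and from $(d+1,\mu+(1^n))$ with the same fillings are identified. The character is $S^{\mathcal A/\mathcal B}_\lambda=\sum_{(T^+,T^-)\in SST_{\mathcal A/\mathcal B}(\lambda)}\mathbf x_{\mathcal A}^{T^+}(\mathbf x_{\mathcal B}^{T^-})^{-1}\in\mathbb Z[[\mathbf x_{\mathcal A},\mathbf x_{\mathcal B}^{-1}]]$, where $\mathbf x_{\mathcal A}=\{x_a\}_{a\in\mathcal A}$, $\mathbf x_{\mathcal B}^{-1}=\{x_b^{-1}\}_{b\in\mathcal B}$ are (independent) variables, and $\mathbf x^{T}=\prod_a x_a^{m_a}$ with $m_a$ the number of occurrences of $a$ in $T$. *)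

(* Defs.v *)
From HB Require Import structures.
From mathcomp Require Import all_boot all_order all_algebra.
From mathcomp Require Import zify finmap multiset.
From mathcomp Require Import mathcomp_extra boolp classical_sets functions.
From mathcomp Require Import cardinality fsbigop.

Set Implicit Arguments.
Unset Strict Implicit.
Unset Printing Implicit Defensive.

Import Order.TTheory GRing.Theory Num.Theory.

Local Open Scope ring_scope.

(* The ring Z[[x_k | k \in K]] for an arbitrary, possibly infinite, set K of
   commuting variables: a series is its coefficient function, and a monomial
   is the finite multiset of its variables. *)
Definition mseries (K : choiceType) : Type := {mset K}%mset -> int.

HB.instance Definition _ (K : choiceType) :=
  GRing.Zmodule.copy (mseries K) ({mset K}%mset -> int).

Section SeriesRing.
Variable K : choiceType.
Implicit Types (f g h : mseries K) (m : {mset K}%mset).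

Definition mmono m : mseries K := fun m' => (m' == m)%:R.

Definition splits m : set ({mset K}%mset * {mset K}%mset) :=
  [set p | msetD p.1 p.2 = m]%classic.

Lemma finite_splits m : finite_set (splits m).
Proof.
pose X := finsupp m.
pose k := \max_(x : X) m (val x).
pose G (w : {ffun X -> 'I_k.+1}) : {mset K}%mset :=
  [fsfun x : X => nat_of_ord (w x)].
pose F w := (G w, msetB m (G w)).
apply: (@sub_finite_set _ _ (F @` setT)%classic); last first.
  exact/finite_image/finite_finset.
move=> [m1 m2] /= m12.
have le1 x : (m1 x <= m x)%N by rewrite -m12 msetE2 leq_addr.
have G1 : G [ffun x : X => inord (m1 (val x))] = m1.
  apply/fsfunP => x; rewrite fsfun_ffun.
  case: insubP => [u _ ux|]; last first.
    rewrite -/X /X mem_finsupp negbK => /eqP mx0.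
    by move: (le1 x); rewrite mx0 leqn0 => /eqP.
  rewrite /= ffunE inordK ux// ltnS (leq_trans (le1 x))// -ux.
  exact: (leq_bigmax (F := fun u : X => m (val u))).
exists [ffun x : X => inord (m1 (val x))] => //.
by rewrite /F G1 -m12 msetDKB.
Qed.

Definition mseries_one : mseries K := mmono mset0.

(* The Cauchy product: the sum is finite by [finite_splits]. *)
Definition mseries_mul f g : mseries K :=
  fun m => \sum_(p \in splits m) f p.1 * g p.2.

Lemma mem_splits m p : (p \in fset_set (splits m)) = (msetD p.1 p.2 == m).
Proof.
rewrite in_fset_set; last exact: finite_splits.
by apply/idP/eqP => [/set_mem|] // ?; apply/mem_set.
Qed.

Lemma mseries_mulE f g m :
  mseries_mul f g m = \sum_(p <- fset_set (splits m)) f p.1 * g p.2.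
Proof. by rewrite /mseries_mul fsbig_finite//; exact: finite_splits. Qed.

Lemma mseries_mulC : commutative mseries_mul.
Proof.
move=> f g; apply/funext => m; rewrite !mseries_mulE.
pose sw (p : {mset K}%mset * {mset K}%mset) := (p.2, p.1).
rewrite (perm_big (map sw (fset_set (splits m)))) ?big_map /=.
  by apply: eq_bigr => p _; rewrite mulrC.
have swK : cancel sw sw by case.
apply: uniq_perm; rewrite ?fset_uniq ?(map_inj_uniq (can_inj swK)) ?fset_uniq//.
move=> p; rewrite -[p in RHS]swK (mem_map (can_inj swK)) !mem_splits.
by rewrite /sw /= msetDC.
Qed.

Lemma mseries_mulA : associative mseries_mul.
Proof.
move=> f g h; apply/funext => m.
pose S m := fset_set (splits m).
pose lhs := [seq (p.1, q.1, q.2) | p <- S m, q <- S p.2].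
pose rhs := [seq (q.1, q.2, p.2) | p <- S m, q <- S p.1].
transitivity (\sum_(t <- lhs) f t.1.1 * g t.1.2 * h t.2).
  rewrite mseries_mulE big_allpairs_dep /=; apply: eq_bigr => p _.
  rewrite mseries_mulE big_distrr /=; apply: eq_bigr => q _.
  by rewrite mulrA.
transitivity (\sum_(t <- rhs) f t.1.1 * g t.1.2 * h t.2); last first.
  rewrite mseries_mulE big_allpairs_dep /=; apply: eq_bigr => p _.
  by rewrite mseries_mulE big_distrl.
apply: perm_big; apply: uniq_perm.
- apply: allpairs_uniq_dep => [|p _|]; rewrite ?fset_uniq//.
  move=> _ _ /allpairsPdep[p [q [_ + ->]]] /allpairsPdep[p' [q' [_ + ->]]] /=.
  rewrite !mem_splits => /eqP + /eqP.
  case: p p' q q' => [p1 p2] [p1' p2'] [q1 q2] [q1' q2'] /= <- <-.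
  by case=> -> -> ->.
- apply: allpairs_uniq_dep => [|p _|]; rewrite ?fset_uniq//.
  move=> _ _ /allpairsPdep[p [q [_ + ->]]] /allpairsPdep[p' [q' [_ + ->]]] /=.
  rewrite !mem_splits => /eqP + /eqP.
  case: p p' q q' => [p1 p2] [p1' p2'] [q1 q2] [q1' q2'] /= <- <-.
  by case=> -> -> ->.
move=> [[a b] c]; apply/allpairsPdep/allpairsPdep.
- move=> [[p1 p2] [[q1 q2] []]]; rewrite !mem_splits/= => /eqP + /eqP qp.
  rewrite -qp => <- [-> -> ->].
  by exists (msetD p1 q1, q2), (p1, q1); rewrite !mem_splits /= msetDA !eqxx.
- move=> [[p1 p2] [[q1 q2] []]]; rewrite !mem_splits/= => /eqP + /eqP qp.
  rewrite -qp => <- [-> -> ->].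
  by exists (q1, msetD q2 p2), (q2, p2); rewrite !mem_splits /= msetDA !eqxx.
Qed.

Lemma mseries_mul1 : left_id mseries_one mseries_mul.
Proof.
move=> f; apply/funext => m; rewrite mseries_mulE.
have mS : (mset0, m) \in fset_set (splits m) by rewrite mem_splits mset0D.
rewrite (big_rem _ mS) /= [mseries_one _]/mseries_one /mmono eqxx mul1r.
rewrite big1_seq ?addr0// => -[p1 p2] /andP[_].
rewrite mem_rem_uniq ?fset_uniq// !inE mem_splits /= => /andP[+ /eqP pm].
rewrite -pm /mseries_one /mmono; case: (p1 =P mset0) => [->|_ _].
  by rewrite mset0D eqxx.
by rewrite mul0r.
Qed.

Lemma mseries_mulDl : left_distributive mseries_mul +%R.
Proof.
move=> f g h; apply/funext => m.
rewrite [RHS]/GRing.add /= !mseries_mulE -big_split /=.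
by apply: eq_bigr => p _; rewrite -mulrDl.
Qed.

Lemma mseries_one_neq0 : mseries_one != 0.
Proof.
apply/eqP => /(congr1 (fun f : mseries K => f mset0)).
by rewrite /mseries_one /mmono eqxx.
Qed.

HB.instance Definition _ := GRing.Zmodule_isComNzRing.Build (mseries K)
  mseries_mulA mseries_mulC mseries_mul1 mseries_mulDl mseries_one_neq0.

End SeriesRing.

(* Generalized partitions of level n, i.e. Z_+^n inside Z^n, and the
   partitions of length at most n among them. *)
Definition gpart n (la : 'rV[int]_n) : Prop :=
  forall i j : 'I_n, (i <= j)%N -> la 0 j <= la 0 i.

Definition part n (la : 'rV[int]_n) : Prop :=
  gpart la /\ forall i, 0 <= la 0 i.

Definition dincl n (mu la : 'rV[int]_n) : Prop := forall i, mu 0 i <= la 0 i.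

(* (d^n) *)
Definition rect n (d : nat) : 'rV[int]_n := const_mx d%:Z.

(* A cell is (row, column).  Rows are numbered from 0; the columns of a diagram
   are numbered from 1, and column positions are integers so that diagrams can
   be translated horizontally. *)
Definition cell n : choiceType := ('I_n * int)%type.

Definition skew_cell n (la mu : 'rV[int]_n) (c : cell n) : bool :=
  mu 0 c.1 < c.2 <= la 0 c.1.

Definition filling n (A : choiceType) := {fmap cell n -> A}.

(* [A1] is the set of odd elements of A; its complement is A_0. *)
Definition SST d (A : orderType d) (A1 : {pred A}) n (la mu : 'rV[int]_n) :
    set (filling n A) :=
  [set T | [/\ forall c, (c \in domf T) = skew_cell la mu c,
    (forall (i : 'I_n) (j j' : int) (a a' : A), j < j' ->
       T.[? (i, j)]%fmap = Some a -> T.[? (i, j')]%fmap = Some a' ->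
       (a <= a')%O /\ (a \in A1 -> a' \in A1 -> (a < a')%O)) &
    (forall (i i' : 'I_n) (j : int) (a a' : A), (i < i')%N ->
       T.[? (i, j)]%fmap = Some a -> T.[? (i', j)]%fmap = Some a' ->
       (a <= a')%O /\ (a \notin A1 -> a' \notin A1 -> (a < a')%O))]]%classic.

(* [P] is the filling [T] with column positions measured from the vertical line
   after column d. *)
Definition placed n (A : choiceType) (d : nat) (T P : filling n A) : Prop :=
  forall (i : 'I_n) (j : int), P.[? (i, j - d%:Z)]%fmap = T.[? (i, j)]%fmap.

(* Pairs of fillings in absolute position: (d, mu) and (d + 1, mu + (1^n)) with
   the same fillings give the same element. *)
Definition rSST dA dB (A : orderType dA) (B : orderType dB)
    (A1 : {pred A}) (B1 : {pred B}) n (la : 'rV[int]_n) :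
    set (filling n A * filling n B) :=
  [set P | exists (d : nat) (mu : 'rV[int]_n) (Tp : filling n A)
                  (Tm : filling n B),
    [/\ part (la + rect n d), part mu, dincl mu (rect n d)
      & dincl mu (la + rect n d)] /\
    [/\ SST A1 (la + rect n d) mu Tp, SST B1 (rect n d) mu Tm,
        placed d Tp P.1 & placed d Tm P.2]]%classic.

(* The variable x_a is indexed by [inl a], and x_b^-1 by [inr b]. *)
Definition weight (A B : choiceType) n (P : filling n A * filling n B) :
    {mset (A + B)%type}%mset :=
  seq_mset ([seq inl (P.1 c) | c : domf P.1] ++
            [seq inr (P.2 c) | c : domf P.2]).

Section FiniteWeight.
Variables (dA dB : Order.disp_t) (A : orderType dA) (B : orderType dB).
Variables (A1 : {pred A}) (B1 : {pred B}) (n : nat) (la : 'rV[int]_n).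

Lemma finite_fillings (C : choiceType) (X : {fset cell n}) (Y : {fset C}) :
  finite_set [set T : filling n C | {subset domf T <= X} /\
    forall c a, T.[? c]%fmap = Some a -> a \in Y]%classic.
Proof.
set S := (X in finite_set X).
pose F (T : filling n C) : {ffun X -> option Y} :=
  [ffun x : X => obind (insub : C -> option Y) T.[? val x]%fmap].
have Finj : {in S &, injective F}.
  move=> T T' /set_mem[TX TY] /set_mem[TX' TY'] /ffunP eqF.
  apply/fmapP => c; case: (boolP (c \in X)) => [cX|cX]; last first.
    by rewrite !not_fnd//; apply: contra cX; [exact: TX' | exact: TX].
  have := eqF [` cX]%fset; rewrite !ffunE /=.
  case Tc : (T.[? c]%fmap) => [a|]; case Tc' : (T'.[? c]%fmap) => [a'|] //=.
  - have aY := TY _ _ Tc; have aY' := TY' _ _ Tc'.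
    by rewrite !insubT => -[->].
  - by have aY := TY _ _ Tc; rewrite insubT.
  - by have aY := TY' _ _ Tc'; rewrite insubT.
have := inj_card_eq Finj => /eq_finite_set <-.
exact: finite_finset.
Qed.

Lemma placed_dom (C : choiceType) d (T P : filling n C) : placed d T P ->
  forall i j, ((i, j) \in domf P) = ((i, j + d%:Z) \in domf T).
Proof. by move=> pl i j; rewrite -!fndSome -pl addrK. Qed.

Lemma weight_inl (P : filling n A * filling n B) c a : P.1.[? c]%fmap = Some a ->
  inl a \in (weight P : {mset (A + B)%type}%mset).
Proof.
rewrite /weight (perm_mem (perm_eq_seq_mset _)) mem_cat => Pc.
have cP : c \in domf P.1 by rewrite -fndSome Pc.
apply/orP; left; apply/mapP; exists [` cP]%fset; rewrite ?mem_enum//.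
by move: Pc; rewrite in_fnd => -[<-].
Qed.

Lemma weight_inr (P : filling n A * filling n B) c b : P.2.[? c]%fmap = Some b ->
  inr b \in (weight P : {mset (A + B)%type}%mset).
Proof.
rewrite /weight (perm_mem (perm_eq_seq_mset _)) mem_cat => Pc.
have cP : c \in domf P.2 by rewrite -fndSome Pc.
apply/orP; right; apply/mapP; exists [` cP]%fset; rewrite ?mem_enum//.
by move: Pc; rewrite in_fnd => -[<-].
Qed.

Lemma size_weight (P : filling n A * filling n B) :
  (#|` domf P.2| <= size (weight P))%N.
Proof.
rewrite /weight (perm_size (perm_eq_seq_mset _)) size_cat !size_image.
by rewrite -!cardfE leq_addl.
Qed.

Lemma finite_rSST_weight (m : {mset (A + B)%type}%mset) :
  finite_set [set P | rSST A1 B1 la P /\ weight P = m]%classic.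
Proof.
pose N := size m.
pose M : nat := (\sum_i `|la ord0 i|)%N.
pose K := (N + M).+1.
pose X : {fset cell n} :=
  [fset c in [seq ((p.1, (p.2 : nat)%:Z - N%:Z) : cell n) | p : 'I_n * 'I_K]]%fset.
pose YA : {fset A} :=
  [fset a in pmap (fun x : A + B => if x is inl a then Some a else None) m]%fset.
pose YB : {fset B} :=
  [fset a in pmap (fun x : A + B => if x is inr a then Some a else None) m]%fset.
have := finite_setX (finite_fillings X YA) (finite_fillings X YB).
apply: sub_finite_set => P [[d [mu [Tp [Tm]]]]].
case=> -[[_ _] [_ _] mud mula] [[domp _ _] [domm _ _] plp plm] Pm.
have leM i : la 0 i <= M%:Z.
  apply: le_trans (ler_norm _) _; rewrite -abszE lez_nat.
  by rewrite /M (bigD1 i) //= leq_addr.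
have domX i (c : int) : mu 0 i - d%:Z < c -> c <= M%:Z -> (i, c) \in X.
  move=> lec cM.
  have NX : - N%:Z <= mu 0 i - d%:Z.
    rewrite leNgt; apply/negP => muN.
    pose s := [seq ((i, - k%:Z) : cell n) | k <- iota 0 N.+1].
    have : (size s <= size (domf P.2))%N.
      have Us : uniq s.
        by rewrite map_inj_uniq ?iota_uniq// => k k' /(congr1 snd) /=; lia.
      apply: (uniq_leq_size Us) => x /mapP[k]; rewrite mem_iota add0n ltnS => /andP[_ kN] ->.
      rewrite (placed_dom plm) domm /skew_cell /= mxE.
      have : k%:Z <= N%:Z by rewrite lez_nat.
      by move: muN; lia.
    rewrite size_map size_iota => /leq_trans/(_ (size_weight P)).
    by rewrite Pm ltnn.
  have c0 : 0 <= c + N%:Z by lia.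
  have cK : (absz (c + N%:Z)%R < K)%N by rewrite /K; lia.
  rewrite inE; apply/mapP; exists (i, Ordinal cK); rewrite ?mem_enum//=.
  by rewrite gez0_abs// addrK.
split; split.
- move=> [i c]; rewrite (placed_dom plp) domp /skew_cell /= !mxE.
  case/andP => lec cla; apply: domX; first by lia.
  by move: cla; rewrite lerD2r => /le_trans; apply.
- move=> c a /weight_inl; rewrite Pm !inE mem_pmap => am.
  by apply/mapP; exists (inl a).
- move=> [i c]; rewrite (placed_dom plm) domm /skew_cell /= !mxE.
  case/andP => lec cla; apply: domX; first by lia.
  by lia.
- move=> c a /weight_inr; rewrite Pm !inE mem_pmap => am.
  by apply/mapP; exists (inr a).
Qed.

End FiniteWeight.

(* The sum of the monomials x_A^{T^+} (x_B^{T^-})^{-1}, taken coefficientwise;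
   each coefficient is a finite sum by [finite_rSST_weight]. *)
Definition rchar dA dB (A : orderType dA) (B : orderType dB)
    (A1 : {pred A}) (B1 : {pred B}) n (la : 'rV[int]_n) :
    mseries (A + B)%type :=
  fun m => \sum_(P \in rSST A1 B1 la) mmono (weight P) m.

(* Main.v *)
(* Cutting a rational tableau along mu - (d^n) gives
     S_la = sum_mu s_{la/mu}(A) s_{0/mu}(B),
   over generalized partitions mu contained in 0 and in la.  Both skew factors
   are given by the Jacobi-Trudi formula, that is, they are minors of Toeplitz
   matrices with rows and columns indexed by the beta-numbers la_i - i and
   mu_j - j; Cauchy-Binet then turns the sum over mu into a minor of a product,
   and the case n = 1 identifies the entries of this product.  The Jacobi-Trudi
   formula comes from Cauchy-Binet again, removing the largest letter of a
   tableau: for a single letter it says that a minor is a monomial on strips and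
   vanishes otherwise.  As A and B are infinite and only linearly ordered, the
   argument is run modulo the monomials not dividing a given m0, so that only
   the letters of m0 and finitely many mu matter. *)
Require Import Defs.
From mathcomp Require Import all_boot all_order all_fingroup all_algebra.
From mathcomp Require Import zify finmap multiset.
From mathcomp Require Import boolp classical_sets cardinality fsbigop.

Set Implicit Arguments.
Unset Strict Implicit.
Unset Printing Implicit Defensive.

Import Order.TTheory GRing.Theory Num.Theory.

Local Open Scope ring_scope.

(** * The Cauchy-Binet formula *)

(** Each set of [n] indices has one decreasing enumeration, so these maps index minors; beta-numbers
    of generalized partitions decrease as well. *)
Definition sdec n M (h : {ffun 'I_n -> 'I_M}) : bool :=
  [forall i : 'I_n, forall j : 'I_n, (i < j)%N ==> (h j < h i)%N].

Lemma sdecP n M (h : {ffun 'I_n -> 'I_M}) :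
  reflect (forall i j : 'I_n, (i < j)%N -> (h j < h i)%N) (sdec h).
Proof.
by apply: (iffP 'forall_'forall_implyP) => H i j; [exact: H|exact: H].
Qed.

Lemma sdec_inj n M (h : {ffun 'I_n -> 'I_M}) : sdec h -> injective h.
Proof.
move=> /sdecP hd i j hij; apply/val_inj/eqP.
by case: ltngtP => // /hd; rewrite hij ltnn.
Qed.

Lemma sdec_sorted n M (h : {ffun 'I_n -> 'I_M}) :
  sdec h -> sorted (fun x y : 'I_M => (y < x)%N) (codom h).
Proof.
move=> /sdecP hd; rewrite codomE; rewrite sorted_map.
apply: (@sub_sorted _ (fun i j : 'I_n => (i < j)%N)) => [i j /hd|]; first by [].

rewrite -[sorted _ _]/(sorted (relpre (@nat_of_ord n) ltn) (enum 'I_n)) -sorted_map.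
by rewrite val_enum_ord iota_ltn_sorted.
Qed.

Lemma sdec_codom_inj n M (g h : {ffun 'I_n -> 'I_M}) :
  sdec g -> sdec h -> codom g =i codom h -> g = h.
Proof.
move=> gd hd gh; apply/ffunP => i.
have : codom g = codom h.
  apply: (irr_sorted_eq _ _ (sdec_sorted gd) (sdec_sorted hd) gh).
    by move=> x y z /= xy yz; exact: ltn_trans yz xy.
  by move=> x /=; rewrite ltnn.
by rewrite !codomE => /eq_in_map; apply; rewrite mem_enum.
Qed.

(** [g] is the sorted tuple of the values of [f]; injectivity makes the sorting strict. *)
Lemma sdec_sort n M (f : {ffun 'I_n -> 'I_M}) : injective f ->
  exists (s : 'S_n) (g : {ffun 'I_n -> 'I_M}), sdec g /\ f = [ffun i => g (s i)].
Proof.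
move=> finj.
pose t := [tuple f i | i < n].
have sz : size (sort (fun x y : 'I_M => (y <= x)%N) t) = n.
  by rewrite size_sort size_tuple.
pose u := Tuple (introT eqP sz).
have : perm_eq t u by rewrite perm_sym /= perm_sort.
case/tuple_permP => s tE.
have fE i : f i = tnth u (s i).
  have -> : f i = tnth t i by rewrite tnth_mktuple.
  have -> : t = [tuple tnth u (s i) | i < n] by apply: val_inj.
  by rewrite tnth_mktuple.
exists s, [ffun i => tnth u i]; split; last first.
  by apply/ffunP => i; rewrite !ffunE fE.
apply/sdecP => i j ij; rewrite !ffunE ltn_neqAle; apply/andP; split.
  apply/eqP => /val_inj uij.
  have : f ((s^-1)%g j) = f ((s^-1)%g i) by rewrite !fE !permKV.
  by move/finj/perm_inj => ji; rewrite ji ltnn in ij.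
have := @sort_sorted _ (fun x y : 'I_M => (y <= x)%N)
  (fun x y => leq_total y x) t.
have tr : transitive (fun x y : 'I_M => (y <= x)%N).
  by move=> x y z /= xy yz; exact: leq_trans yz xy.
(* [nth] needs a default element, and ['I_M] could a priori be empty. *)
have [x0 _] : exists x0 : 'I_M, True by exists (f i).
move/(sorted_leq_nth tr (fun x => leqnn x) x0).
move=> /(_ i j); rewrite !inE !size_sort !size_tuple !ltn_ord => /(_ isT isT (ltnW ij)).
by rewrite !(tnth_nth x0).
Qed.

(** Expanding the rows of the product gives a sum over all maps [f]. Those that are not injective
    repeat a row of [Y]; the others factor uniquely as a decreasing map after a permutation, and the
    signs assemble the minor of [X]. *)
Lemma Cauchy_Binet (R : comNzRingType) n M (X : 'M[R]_(n, M)) (Y : 'M[R]_(M, n)) :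
  \det (X *m Y) =
  \sum_(g : {ffun 'I_n -> 'I_M} | sdec g) \det (colsub g X) * \det (rowsub g Y).
Proof.
transitivity (\sum_(f : {ffun 'I_n -> 'I_M}) (\prod_i X i (f i)) * \det (rowsub f Y)).
  rewrite /determinant.
  under [RHS]eq_bigr do rewrite big_distrr /=.
  rewrite exchange_big /=; apply: eq_bigr => s _.
  under eq_bigr do rewrite mxE.
  rewrite bigA_distr_bigA big_distrr /=; apply: eq_bigr => f _.
  rewrite mulrCA; congr (_ * _); rewrite -big_split /=.
  by apply: eq_bigr => i _; rewrite mxE.
rewrite (bigID (fun f : {ffun 'I_n -> 'I_M} => injectiveb f)) /=.
rewrite [X in _ + X]big1 ?addr0; last first.
  move=> f /injectivePn[i [j ij fij]].
  rewrite (determinant_alternate ij) ?mulr0// => k.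
  by rewrite !mxE fij.
pose F (p : {ffun 'I_n -> 'I_M} * 'S_n) := [ffun i => p.1 (p.2 i)].
have Finj : {in [pred p | sdec p.1] &, injective F}.
  move=> [g s] [g' s'] /=; rewrite !inE /= => gd gd' /ffunP FF.
  have gg : g = g'.
    apply: sdec_codom_inj => // x; apply/codomP/codomP => -[i ->].
      by exists (s' (s^-1 i)%g); move: (FF (s^-1 i)%g); rewrite !ffunE permKV.
    by exists (s (s'^-1 i)%g); move: (FF (s'^-1 i)%g); rewrite !ffunE permKV.
  congr (_, _) => //; apply/permP => i; apply: (sdec_inj gd).
  by move: (FF i); rewrite !ffunE /= -gg.

pose G (f : {ffun 'I_n -> 'I_M}) := (\prod_i X i (f i)) * \det (rowsub f Y).
transitivity (\sum_(f in [set F p | p in [pred p | sdec p.1]]) G f).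
  apply: eq_bigl => f; apply/injectiveP/imsetP => [/sdec_sort[s [g [gd ->]]]|].
    by exists (g, s).
  move=> [[g s]]; rewrite inE /= => gd -> i j; rewrite !ffunE /=.
  by move/(sdec_inj gd)/perm_inj.
rewrite (big_imset _ Finj) /= (eq_bigl (fun p => sdec p.1 && true)); last first.
  by move=> p; rewrite andbT.
rewrite -(pair_big_dep (fun g => sdec g) (fun _ _ => true) (fun g s => G (F (g, s)))) /=.
apply: eq_bigr => g gd; rewrite big_distrl /=; apply: eq_bigr => s _.
(* Permuting the rows of [rowsub g Y] by [s] contributes the sign of [s]. *)
have -> : G (F (g, s)) = (\prod_i X i (g (s i))) * ((-1) ^+ s * \det (rowsub g Y)).
  rewrite /G; congr (_ * _); first by apply: eq_bigr => i _; rewrite ffunE.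
  rewrite -det_perm -det_mulmx -row_permE; congr (\det _).
  by apply/matrixP => i j; rewrite !mxE ffunE.
rewrite mulrA (mulrC (\prod_i _)); congr (_ * _ * _).
by apply: eq_bigr => i _; rewrite mxE.
Qed.

(** Serves twice: to add one letter to a tableau, and to glue the [A]-part and the [B]-part along
    their common inner shape. *)
Lemma det_mxsub_mul (R : comNzRingType) n M (X Y : 'M[R]_M)
    (h k : {ffun 'I_n -> 'I_M}) :
  \det (mxsub h k (X *m Y)) =
  \sum_(g : {ffun 'I_n -> 'I_M} | sdec g) \det (mxsub h g X) * \det (mxsub g k Y).
Proof.
rewrite mxsub_mul Cauchy_Binet; apply: eq_bigr => g gd.
by congr (_ * _); congr (\det _); apply/matrixP => i j; rewrite !mxE.
Qed.

(** * Minors of the transfer matrix of a letter *)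

(* The coefficient of z^(p - q) in the series 1 + x z of an odd letter (b), or
   1 / (1 - x z) of an even one. *)
Definition letter_entry (R : comNzRingType) (b : bool) (x : R) (p q : nat) : R :=
  if b then (p == q)%:R + x *+ (p == q.+1) else x ^+ (p - q) *+ (q <= p)%N.

(* [strip] below, in terms of beta-numbers. *)
Definition beta_strip (b : bool) n (h g : 'I_n -> nat) : bool :=
  [forall i, (g i <= h i)%N && (b ==> (h i <= (g i).+1)%N)] &&
  [forall i : 'I_n, forall j : 'I_n, ~~ b && (i < j)%N ==> (h j < g i)%N].

Lemma beta_stripP (b : bool) n (h g : 'I_n -> nat) :
  reflect ((forall i, (g i <= h i)%N /\ (b -> (h i <= (g i).+1)%N)) /\
           (forall i j : 'I_n, ~~ b -> (i < j)%N -> (h j < g i)%N))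
          (beta_strip b h g).
Proof.
apply: (iffP andP) => -[H1 H2]; split.
- by move=> i; have /forallP/(_ i)/andP[? /implyP] := H1.
- move=> i j bN ij; have /forallP/(_ i)/forallP/(_ j) := H2.
  by rewrite bN ij.
- by apply/forallP => i; have [-> /implyP] := H1 i.
- by apply/'forall_'forall_implyP => i j /andP[? ?]; exact: H2.
Qed.

(** Splits off the first row, to match the expansion of the determinant at its corner. *)
Lemma beta_strip_recl (b : bool) n (h g : 'I_n.+1 -> nat) :
  beta_strip b h g = [&& (g ord0 <= h ord0)%N, b ==> (h ord0 <= (g ord0).+1)%N,
    b || [forall j : 'I_n, (h (lift ord0 j) < g ord0)%N]
    & beta_strip b (fun i => h (lift ord0 i)) (fun i => g (lift ord0 i))].
Proof.
apply/beta_stripP/and4P => [[H1 H2]|[H3 /implyP H4 H5 /beta_stripP[H1 H2]]]; split.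
- by have [] := H1 ord0.
- by have [_ /implyP] := H1 ord0.
- case: (boolP b) => //= bN; apply/forallP => j; exact: H2.
- by apply/beta_stripP; split=> [i|i j bN ij]; [exact: H1|exact: H2].
- by move=> i; case: (unliftP ord0 i) => [j|] ->.
- move=> i j bN; move: H5; rewrite (negPf bN) /= => /forallP H5.
  case: (unliftP ord0 j) => [j'|] ->; last by rewrite ltn0.
  case: (unliftP ord0 i) => [i'|] -> // ij; exact: H2.
Qed.

(* Either the first row or column has no nonzero entry outside the corner, and
   one recurses, or the first row is proportional to another one. *)
Lemma det_letter (R : comNzRingType) (b : bool) (x : R) n (h g : 'I_n -> nat) :
  (forall i j : 'I_n, (i < j)%N -> (h j < h i)%N) ->
  (forall i j : 'I_n, (i < j)%N -> (g j < g i)%N) ->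
  \det (\matrix_(i < n, j < n) letter_entry b x (h i) (g j)) =
  x ^+ (\sum_i (h i - g i)) *+ beta_strip b h g.
Proof.
elim: n => [|n IH] in h g *; move=> hd gd.
  rewrite det_mx00 big_ord0; suff -> : beta_strip b h g by [].
  by apply/beta_stripP; split=> -[].
have h0 j : (h (lift ord0 j) < h ord0)%N by apply: hd.
have g0 j : (g (lift ord0 j) < g ord0)%N by apply: gd.
set A := \matrix_(i, j) _.
have minorE : \det (row' ord0 (col' ord0 A)) =
    x ^+ (\sum_i (h (lift ord0 i) - g (lift ord0 i))) *+
      beta_strip b (fun i => h (lift ord0 i)) (fun i => g (lift ord0 i)).
  rewrite -IH => [|i j ij|i j ij]; [|exact: hd|exact: gd].
  by congr (\det _); apply/matrixP => i j; rewrite !mxE.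
have corner : letter_entry b x (h ord0) (g ord0) = x ^+ (h ord0 - g ord0) *+
    ((g ord0 <= h ord0)%N && (b ==> (h ord0 <= (g ord0).+1)%N)).
  rewrite /letter_entry; case: (b) => /=; last by rewrite andbT.
  case: (ltngtP (h ord0) (g ord0)) => [hg|gh|->].
  - by rewrite [_ == _](_ : _ = false) ?addr0//; lia.
  - rewrite add0r eqn_leq gh andbT; case: leqP => //= hg.
    by have -> : (h ord0 - g ord0)%N = 1%N by lia.
  - by rewrite subnn leqnSn /= [_ == _](_ : _ = false) ?addr0//; lia.
have cornerP : (forall i, A (lift ord0 i) ord0 = 0) \/
      (forall j, A ord0 (lift ord0 j) = 0) ->
    \det A = A ord0 ord0 * \det (row' ord0 (col' ord0 A)).
  case=> z; [rewrite (expand_det_col _ ord0)|rewrite (expand_det_row _ ord0)];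
    rewrite big_ord_recl big1 ?addr0; try by move=> i _; rewrite z mul0r.
    by rewrite /cofactor /= expr0 mul1r.
  by rewrite /cofactor /= expr0 mul1r.
have step : (forall i, A (lift ord0 i) ord0 = 0) \/
      (forall j, A ord0 (lift ord0 j) = 0) ->
    b || [forall j : 'I_n, (h (lift ord0 j) < g ord0)%N] ->
    \det A = x ^+ (\sum_i (h i - g i)) *+ beta_strip b h g.
  move=> /cornerP -> bh; rewrite minorE beta_strip_recl bh mxE corner /=.
  by rewrite mulrnAl mulrnAr -exprD -mulrnA mulnb andbC -andbA big_ord_recl.
case: (boolP (b || [forall j : 'I_n, (h (lift ord0 j) < g ord0)%N])) => [bh|]; last first.
  (* Even letter, and a row below the first whose [h] reaches [g ord0]: no entry of that row or of
     the first is cut off, so the two differ by a power of [x]. *)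
  rewrite negb_or => /andP[bN /forallPn[j]]; rewrite -leqNgt => gh.
  rewrite beta_strip_recl (negPf bN) /= [X in [&& _, X & _]](_ : _ = false); last first.
    by apply/negP => /forallP/(_ j); rewrite ltnNge gh.
  rewrite andbF mulr0n.
  have i0j : ord0 != lift ord0 j by exact: neq_lift.
  have gall k : (g k <= g ord0)%N.
    by case: (unliftP ord0 k) => [k'|] ->; rewrite // ltnW.
  pose c := x ^+ (h ord0 - h (lift ord0 j)).
  have AE k : A ord0 k = c * A (lift ord0 j) k.
    have gk := leq_trans (gall k) gh; have gk0 := leq_trans gk (ltnW (h0 j)).
    rewrite !mxE /letter_entry (negPf bN) gk gk0 /c -exprD.
    by rewrite addnBA// subnK// ltnW.
  clearbody A.
  pose B := \matrix_(i, k) (if i == ord0 then A (lift ord0 j) k else A i k).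
  have B0 : \det B = 0.
    rewrite (determinant_alternate i0j)// => k.
    by rewrite ![B _ _]mxE eqxx eq_sym (negPf i0j).
  (* The first row of [A] is [c] times that of [B]; the second summand is a dummy with coefficient
     0. *)
  rewrite (@determinant_multilinear _ _ A B B ord0 c 0) ?B0 ?mulr0 ?addr0//.
  - by apply/rowP => k; rewrite !mxE eqxx mul0r addr0 AE.
  - by apply/matrixP => i k; rewrite !mxE eq_sym (negPf (neq_lift _ _)).
  - by apply/matrixP => i k; rewrite !mxE eq_sym (negPf (neq_lift _ _)).
have AE i j : A i j = letter_entry b x (h i) (g j) by rewrite mxE.
(* Odd letter: a nonzero entry needs [h] equal to [g] or [g + 1]. If [h ord0 <= g ord0], the lower
   [h] are too small for the first column; otherwise [h ord0] is too large for the later [g]. *)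
have [bT|bN] := orP (orbN b).
  apply: (step _ bh); case: (leqP (h ord0) (g ord0)) => hg; [left => i|right => j];
    rewrite AE /letter_entry bT; [have hi := h0 i|have gj := g0 j].
    have /negPf-> : h (lift ord0 i) != g ord0 by lia.
    by have /negPf-> : h (lift ord0 i) != (g ord0).+1; [lia|rewrite addr0].
  have /negPf-> : h ord0 != g (lift ord0 j) by lia.
  by have /negPf-> : h ord0 != (g (lift ord0 j)).+1; [lia|rewrite addr0].
apply: (step _ bh); left => i; rewrite AE /letter_entry (negPf bN).
by move: bh; rewrite (negPf bN) => /forallP/(_ i); rewrite ltnNge => /negPf ->.
Qed.

(** * Weights of fillings *)

Section Monomials.
Variable K : choiceType.
Implicit Types (m : {mset K}%mset).

Lemma mmonoD m1 m2 : mmono (msetD m1 m2) = mmono m1 * mmono m2.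
Proof.
apply/funext => m; rewrite [RHS]mseries_mulE /mmono.
case: eqP => [->|ne].
  have mS : (m1, m2) \in fset_set (splits (msetD m1 m2)) by rewrite mem_splits.
  rewrite (big_rem _ mS) /= !eqxx mulr1 big1_seq ?addr0// => -[p1 p2] /andP[_].
  rewrite mem_rem_uniq ?fset_uniq// inE xpair_eqE => /andP[+ _] /=.
  by case: (p1 == m1) => /= [/negPf->|_]; rewrite ?mulr0 ?mul0r.
rewrite big1_seq// => -[p1 p2] /andP[_]; rewrite mem_splits /= => /eqP pm.
case: (p1 =P m1) => [e1|_]; last by rewrite mul0r.
case: (p2 =P m2) => [e2|_]; last by rewrite mulr0.
by case: ne; rewrite -pm e1 e2.
Qed.

Lemma mmono_msetn k (x : K) : mmono (msetn k x) = mmono [mset x]%mset ^+ k.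
Proof.
elim: k => [|k IH]; first by rewrite msetn0 expr0.
rewrite exprS -IH -mmonoD; congr mmono; apply/msetP => y.
by rewrite msetE2 !msetnE; case: (y == x).
Qed.

End Monomials.

Section FillingWeight.
Variables (n : nat) (C K : choiceType) (emb : C -> K).
Implicit Types (T S : filling n C).

Definition fweight T : {mset K}%mset := seq_mset [seq emb (T c) | c : domf T].

(** Ranges over plain cells instead of the subtype attached to [T], so that fillings with different
    domains can be compared. *)
Lemma fweight_pmap T : fweight T =
  seq_mset (pmap (fun c => omap emb T.[? c]%fmap) (domf T)).
Proof.
congr seq_mset; rewrite enum_fsetE /image_mem.
elim: (enum _) => //= c s ->.
by rewrite -Some_fnd.
Qed.

Lemma fweight_cat T S : (forall c, c \in domf T -> c \notin domf S) ->
  fweight (catf T S) = msetD (fweight T) (fweight S).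
Proof.
move=> dTS; apply/msetP => y.
rewrite msetE2 !fweight_pmap !mset_seqE -count_cat.
have pTS : perm_eq (domf (catf T S)) (domf T ++ domf S).
  apply: uniq_perm => [||c]; rewrite ?fset_uniq// ?mem_cat ?mem_catf//.
  rewrite cat_uniq !fset_uniq /= andbT; apply/hasPn => c cS.
  by apply/negP => /dTS; rewrite cS.
rewrite (seq.permP (perm_pmap _ pTS)) pmap_cat !count_cat; congr (_ + _)%N.
  congr count; apply: eq_in_pmap => c cT.
  by rewrite fnd_cat (negPf (dTS _ cT)).
by congr count; apply: eq_in_pmap => c cS; rewrite fnd_cat cS.
Qed.

Definition const_fill (X : {fset cell n}) (a : C) : filling n C :=
  [fmap c : X => a]%fmap.

Lemma fnd_const_fill X a c :
  (const_fill X a).[? c]%fmap = if c \in X then Some a else None.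
Proof.
case: (boolP (c \in X)) => cX; last by rewrite not_fnd.
by rewrite in_fnd ffunE.
Qed.

Lemma fweight_const X a : fweight (const_fill X a) = msetn #|` X| (emb a).
Proof.
rewrite /fweight; have -> : [seq emb (const_fill X a c) | c : X] =
    nseq #|` X| (emb a).
  have E c : emb (const_fill X a c) = emb a by rewrite ffunE.
  rewrite /image_mem (eq_map E) cardfE cardE.
  by elim: (enum _) => //= _ s ->.
apply/msetP => y; rewrite mset_seqE msetnE count_nseq /=.
by rewrite eq_sym; case: eqP; rewrite ?mul1n ?mul0n.
Qed.

End FillingWeight.

(** * The cells of a skew diagram as a finite set *)

Section SkewCells.
Variable n : nat.
Implicit Types la mu nu : 'rV[int]_n.

(** The row length is an absolute value, so these are the skew cells only when [mu] lies in [la]. *)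
Definition skew_seq la mu : seq (cell n) :=
  [seq ((i, mu 0 i + k.+1%:Z) : cell n) |
    i <- enum 'I_n, k <- iota 0 (absz (la 0 i - mu 0 i)%R)].

Definition skew_fset la mu : {fset cell n} := [fset c in skew_seq la mu]%fset.

Lemma in_skew_fset la mu c : dincl mu la ->
  (c \in skew_fset la mu) = skew_cell la mu c.
Proof.
move=> mula; rewrite inE /=; case: c => i j; have := mula i => mi.
apply/allpairsPdep/idP => [[i' [k [_ + [-> ->]]]]|].
  by rewrite mem_iota /skew_cell /=; have := mula i'; lia.
rewrite /skew_cell /= => ij; exists i, (absz (j - mu 0 i - 1)%R).
rewrite mem_enum mem_iota; split=> //; first by lia.
by congr pair; lia.
Qed.

Lemma card_skew_fset la mu :
  #|` skew_fset la mu| = (\sum_i absz (la 0 i - mu 0 i)%R)%N.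
Proof.
rewrite /skew_fset card_fseq undup_id.
  rewrite size_allpairs_dep sumnE big_map big_enum /=.
  by apply: eq_bigr => i _; rewrite size_iota.
apply: allpairs_uniq_dep => [|i _|]; rewrite ?enum_uniq ?iota_uniq//.
move=> _ _ /allpairsPdep[i [k [_ _ ->]]] /allpairsPdep[i' [k' [_ _ ->]]] /= [-> ?].
by congr existT; lia.
Qed.

End SkewCells.

(** * Removing the largest letter *)

(* The diagram la / nu is a vertical strip if b, a horizontal strip otherwise. *)
Definition strip (b : bool) n (la nu : 'rV[int]_n) : Prop :=
  (forall i, nu 0 i <= la 0 i /\ (b -> la 0 i <= nu 0 i + 1)) /\
  (forall i i' : 'I_n, ~~ b -> (i < i')%N -> la 0 i' <= nu 0 i).

Section Tableaux.
Variables (d : Order.disp_t) (C : orderType d) (C1 : {pred C}) (n : nat).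
Implicit Types (la mu nu : 'rV[int]_n) (L : seq C) (T : filling n C).

(** A row without cells does not force [mu] below [la] in [SST]; with the inclusion, the filling and
    one of the two shapes determine the other. *)
Definition tabl L la mu : set (filling n C) :=
  [set T | [/\ SST C1 la mu T, dincl mu la &
    forall c a, T.[? c]%fmap = Some a -> a \in L]]%classic.

Lemma finite_tabl L la mu : finite_set (tabl L la mu).
Proof.
apply: sub_finite_set (finite_fillings (skew_fset la mu) [fset x in L]%fset).
move=> T [[domT _ _] mula TL]; split=> [c|c a /TL]; last by rewrite inE.
by rewrite in_skew_fset// domT.
Qed.

Definition tabs L la mu := fset_set (tabl L la mu).

Lemma tabsP L la mu T : reflect (tabl L la mu T) (T \in tabs L la mu).
Proof.
rewrite in_fset_set; last exact: finite_tabl.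
by apply: (iffP idP) => [/set_mem|/mem_set].
Qed.

Definition add_strip a la nu T : filling n C :=
  catf T (const_fill (skew_fset la nu) a).

Lemma fnd_add_strip a la nu T c : dincl nu la ->
  (add_strip a la nu T).[? c]%fmap =
  if skew_cell la nu c then Some a else T.[? c]%fmap.
Proof.
by move=> nula; rewrite fnd_cat fnd_const_fill !in_skew_fset//; case: ifP => [->|].
Qed.

Lemma strip_dincl b la nu : strip b la nu -> dincl nu la.
Proof. by case=> H _ i; have [] := H i. Qed.

Lemma SST_skew la mu T c a : SST C1 la mu T -> T.[? c]%fmap = Some a ->
  skew_cell la mu c.
Proof. by case=> domT _ _ Tc; rewrite -domT -fndSome Tc. Qed.

(** Old letters lie left of or above the new [a] and are smaller, so only two copies of [a] can
    conflict; the strip condition excludes an odd [a] twice in a row and an even [a] twice in a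
    column. *)
Lemma add_strip_tabl a L la nu mu T : gpart nu ->
  (forall b, b \in L -> (b < a)%O) ->
  strip (a \in C1) la nu -> tabl L nu mu T ->
  tabl (rcons L a) la mu (add_strip a la nu T).
Proof.
move=> nug La st [sT munu TL]; have nula := strip_dincl st.
have [domT rowT colT] := sT; have [st1 st2] := st.
have sk c b : T.[? c]%fmap = Some b -> skew_cell nu mu c by exact: SST_skew.
split; [split| |].
- move=> [i j]; rewrite -fndSome fnd_add_strip//.
  have m1 := munu i; have n1 := nula i.
  have := domT (i, j); rewrite -fndSome /skew_cell /= => dE.
  by case: ifP => /= s; rewrite ?dE; lia.
- move=> i j j' x x' jj'; rewrite !fnd_add_strip//.
  case: ifP => [s|_]; case: ifP => [s'|_].
  + move=> [<-] [<-]; split=> // aC _; have [_ /(_ aC)] := st1 i.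
    by move: s s'; rewrite /skew_cell /=; lia.
  + by move=> _ /sk; move: s; rewrite /skew_cell /=; lia.
  + by move=> /TL/La xa [<-]; rewrite xa ltW.
  + exact: rowT.
- move=> i i' j x x' ii'; rewrite !fnd_add_strip//.
  case: ifP => [s|_]; case: ifP => [s'|_].
  + move=> [<-] [<-]; split=> // aC _; have := st2 _ _ aC ii'.
    by move: s s'; rewrite /skew_cell /=; lia.
  + move=> _ /sk; have := nug _ _ (ltnW ii').
    by move: s; rewrite /skew_cell /=; lia.
  + by move=> /TL/La xa [<-]; rewrite xa ltW.
  + exact: colT.
- by move=> i; apply: le_trans (nula i).
- move=> c x; rewrite fnd_add_strip// mem_rcons inE.
  by case: ifP => [_ [->]|_ /TL ->]; rewrite ?eqxx ?orbT.
Qed.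

(* The cells holding the largest letter a end each row of T; nu bounds the
   remaining cells. *)
Lemma tabl_remove_max a L la mu T : gpart la -> gpart mu ->
  (forall b, b \in L -> (b < a)%O) -> tabl (rcons L a) la mu T ->
  exists nu S, [/\ gpart nu, strip (a \in C1) la nu, tabl L nu mu S
    & T = add_strip a la nu S].
Proof.
move=> lag mug La [[domT rowT colT] mula TL].
have Tle c x : T.[? c]%fmap = Some x -> (x <= a)%O.
  by move=> /TL; rewrite mem_rcons inE => /orP[/eqP->|/La/ltW].
have Tdef c : skew_cell la mu c -> exists x, T.[? c]%fmap = Some x.
  by rewrite -domT => cT; exists T.[cT]%fmap; rewrite in_fnd.
have cut i : exists k : int, [/\ mu 0 i <= k, k <= la 0 i &
    forall j, skew_cell la mu (i, j) -> (T.[? (i, j)]%fmap == Some a) = (k < j)].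
  (* The least such [m] counts the cells before the first [a]; the first disjunct covers a row
     without [a]. *)
  pose p (m : nat) := (la 0 i == mu 0 i + m%:Z) ||
    (T.[? (i, (mu 0 i + m.+1%:Z)%R)]%fmap == Some a).
  have exp : exists m, p m.
    by exists (absz (la 0 i - mu 0 i)%R); rewrite /p; have := mula i; lia.
  case: (ex_minnP exp) => m pm mmin; exists (mu 0 i + m%:Z).
  have mle : mu 0 i + m%:Z <= la 0 i.
    have := mmin (absz (la 0 i - mu 0 i)%R); rewrite /p.
    by have := mula i; case: eqP => /=; lia.
  split=> // [|j]; first by lia.
  rewrite /skew_cell /= => /andP[j1 j2].
  case: (ltP (mu 0 i + m%:Z) j) => jm.
    have [y Ty] := Tdef (i, j) (introT andP (conj j1 j2)).
    move: pm; rewrite /p => /orP[/eqP e|/eqP Ta]; first by lia.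
    have [<-|ne] := eqVneq (mu 0 i + m.+1%:Z) j; first by rewrite Ta eqxx.
    have lt : mu 0 i + m.+1%:Z < j by lia.
    have [ay _] := rowT _ _ _ _ _ lt Ta Ty.
    by rewrite Ty; apply/eqP; congr Some; apply/le_anti; rewrite ay (Tle _ _ Ty).
  apply/negP => Ta; have := mmin (absz (j - mu 0 i - 1)%R).
  rewrite /p; have -> : mu 0 i + (absz (j - mu 0 i - 1)%R).+1%:Z = j by lia.
  by rewrite Ta orbT => /(_ isT); lia.
have [k kP] := fin_all_exists cut.
pose nu : 'rV[int]_n := \row_i k i.
have munu : dincl mu nu by move=> i; rewrite mxE; have [] := kP i.
have nula : dincl nu la by move=> i; rewrite mxE; have [] := kP i.
have nuP i j : mu 0 i < j -> j <= la 0 i ->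
    (T.[? (i, j)]%fmap == Some a) = (nu 0 i < j).
  by move=> j1 j2; have [_ _] := kP i; rewrite mxE; apply; rewrite /skew_cell /= j1.
(* If row [i'] of [nu] were longer than row [i], its last cell would hold a letter below [a],
   underneath a cell holding [a]. *)
have nug : gpart nu.
  move=> i i'; rewrite leq_eqVlt => /orP[/eqP/val_inj->//|ii'].
  rewrite leNgt; apply/negP => lt.
  have m1 := munu i; have m2 := mug _ _ (ltnW ii').
  have l1 := nula i'; have l2 := lag _ _ (ltnW ii').
  have : (T.[? (i, nu 0 i')]%fmap == Some a) by rewrite nuP; lia.
  move/eqP => T1.
  have : (T.[? (i', nu 0 i')]%fmap == Some a) = false by rewrite nuP; lia.
  have [|x Tx] := Tdef (i', nu 0 i'); first by rewrite /skew_cell /=; lia.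
  have [ax _] := colT _ _ _ _ _ ii' T1 Tx.
  by rewrite Tx => /eqP; case; congr Some; apply/le_anti; rewrite ax (Tle _ _ Tx).
(* A violation puts two copies of [a] side by side (odd case) or in one column (even case). *)
have st : strip (a \in C1) la nu.
  split=> [i|i i' aC ii'].
    split=> // aC; rewrite leNgt; apply/negP => lt; have m1 := munu i.
    have /eqP T1 : T.[? (i, nu 0 i + 1)]%fmap == Some a by rewrite nuP; lia.
    have /eqP T2 : T.[? (i, nu 0 i + 1 + 1)]%fmap == Some a by rewrite nuP; lia.
    have [|_ /(_ aC aC)] := rowT _ _ _ _ _ _ T1 T2; first by lia.
    by rewrite ltxx.
  rewrite leNgt; apply/negP => lt.
  have m1 := munu i; have m2 := munu i'; have l2 := lag _ _ (ltnW ii').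
  have n1 := nug _ _ (ltnW ii').
  have /eqP T1 : T.[? (i, la 0 i')]%fmap == Some a by rewrite nuP; lia.
  have /eqP T2 : T.[? (i', la 0 i')]%fmap == Some a by rewrite nuP; lia.
  by have [_ /(_ aC aC)] := colT _ _ _ _ _ ii' T1 T2; rewrite ltxx.
have skn c : skew_cell nu mu c -> skew_cell la mu c.
  by case: c => i j; rewrite /skew_cell /=; have := nula i; lia.
pose S := restrictf T (skew_fset nu mu).
have SE c : S.[? c]%fmap = if skew_cell nu mu c then T.[? c]%fmap else None.
  by rewrite fnd_restrict in_skew_fset.
have ST c x : S.[? c]%fmap = Some x -> T.[? c]%fmap = Some x.
  by rewrite SE; case: ifP.
exists nu, S; split=> //.
- split=> //; first split.
  + move=> c; rewrite -fndSome SE; case: ifP => // /skn.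
    by rewrite -domT -fndSome.
  + by move=> i j j' x x' jj' /ST Tx /ST Tx'; exact: rowT jj' Tx Tx'.
  + by move=> i i' j x x' ii' /ST Tx /ST Tx'; exact: colT ii' Tx Tx'.
  + move=> [i j] x Sx; have := TL _ _ (ST _ _ Sx); rewrite mem_rcons inE.
    move: Sx; rewrite SE; case: ifP => // sk Tx /orP[/eqP xa|//].
    have := nuP i j; move: sk; rewrite Tx xa eqxx /skew_cell /=.
    by have := nula i; lia.
- apply/fmapP => -[i j]; rewrite fnd_add_strip// SE.
  have m1 := munu i; have n1 := nula i.
  case: ifP => [|s1]; first by rewrite /skew_cell /= => s; apply/eqP; rewrite nuP; lia.
  case: ifP => // s2; rewrite not_fnd// domT.
  by move: s1 s2; rewrite /skew_cell /=; lia.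
Qed.

Lemma tabl_dom_inj L la la' mu T : tabl L la mu T -> tabl L la' mu T -> la = la'.
Proof.
move=> [[dT _ _] m _] [[dT' _ _] m' _]; apply/rowP => i.
have := dT (i, la 0 i); have := dT (i, la' 0 i); rewrite !dT' /skew_cell /=.
by have := m i; have := m' i; lia.
Qed.

Lemma tabl_mu_inj L la mu mu' T : tabl L la mu T -> tabl L la mu' T -> mu = mu'.
Proof.
move=> [[dT _ _] m _] [[dT' _ _] m' _]; apply/rowP => i.
have := dT (i, mu 0 i); have := dT (i, mu' 0 i); rewrite !dT' /skew_cell /=.
by have := m i; have := m' i; lia.
Qed.

(** Since [a] is not in [L], erasing the cells that hold [a] recovers the old filling, and its
    domain recovers the shape. *)
Lemma add_strip_inj a L la mu nu nu' T T' :
  (forall b, b \in L -> (b < a)%O) ->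
  dincl nu la -> dincl nu' la -> tabl L nu mu T -> tabl L nu' mu T' ->
  add_strip a la nu T = add_strip a la nu' T' -> nu = nu' /\ T = T'.
Proof.
move=> La nula nula' tT tT' e.
have fE la1 mu1 nu1 S c : dincl nu1 la -> tabl L nu1 mu1 S ->
    S.[? c]%fmap = if (add_strip a la nu1 S).[? c]%fmap == Some a then None
    else (add_strip a la nu1 S).[? c]%fmap.
  move=> n1 [sS _ SL]; rewrite fnd_add_strip//.
  case: (boolP (skew_cell la nu1 c)) => [s|_].
    rewrite eqxx; case E : (S.[? c]%fmap) => [x|//].
    by have := SST_skew sS E; move: s; rewrite /skew_cell; lia.
  case E : (S.[? c]%fmap) => [x|//]; case: eqP => // -[xa].
  by have := La _ (SL _ _ E); rewrite xa ltxx.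
have eT : T = T'.
  by apply/fmapP => c; rewrite (fE la mu _ _ _ nula tT) (fE la mu _ _ _ nula' tT') e.
by split=> //; rewrite -eT in tT'; exact: tabl_dom_inj tT tT'.
Qed.

Lemma tabl_nil la mu T : tabl [::] la mu T <-> la = mu /\ T = [fmap]%fmap.
Proof.
split=> [[[dT _ _] m TL]|[-> ->]].
  have T0 c : T.[? c]%fmap = None.
    by case E : (T.[? c]%fmap) => [x|//]; have := TL _ _ E.
  split; last by apply/fmapP => c; rewrite T0 fnd_fmap0.
  apply/rowP => i; have := dT (i, la 0 i); rewrite -fndSome T0 /skew_cell /=.
  by have := m i; lia.
split=> [|//|c a]; last by rewrite fnd_fmap0.
split=> [c|i j j' a a' _|i i' j a a' _]; rewrite ?fnd_fmap0//.
by rewrite in_fset0 /skew_cell; lia.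
Qed.

End Tableaux.

(** * The Jacobi-Trudi formula *)

Section BetaNumbers.
Variables (n M W : nat).
Implicit Types (f g h : {ffun 'I_n -> 'I_M}).

(* The generalized partition with beta-numbers h: la_i = h_i + i - W. *)
Definition beta_part h : 'rV[int]_n := \row_i ((h i)%:Z + i%:Z - W%:Z).

(** Strict decrease of integers loses at least 1 per step, which is why [h i + i] is weakly
    decreasing. *)
Lemma sdec_gap h : sdec h ->
  forall i j : 'I_n, (i <= j)%N -> (h j + (j - i) <= h i)%N.
Proof.
move=> /sdecP hd i [j ltj]; elim: j => [|j IH] in ltj *;
  rewrite leq_eqVlt => /orP[/eqP/val_inj<-|ij]; rewrite ?subnn ?addn0//.
have := IH (ltnW ltj) ij; have := hd (Ordinal (ltnW ltj)) (Ordinal ltj) (leqnn _).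
by rewrite /=; lia.
Qed.

Lemma beta_part_gpart h : sdec h -> gpart (beta_part h).
Proof. by move=> hd i j /(sdec_gap hd); rewrite !mxE; lia. Qed.

Lemma beta_part_inj : injective beta_part.
Proof.
move=> f g /rowP fg; apply/ffunP => i; apply: val_inj => /=.
by have := fg i; rewrite !mxE; lia.
Qed.

(** The bound says that the beta-numbers, shifted by [W], fit in the window of size [M] that indexes
    the matrices. *)
Lemma beta_part_exists (la : 'rV[int]_n) : gpart la ->
  (forall i, 0 <= la 0 i - i%:Z + W%:Z < M%:Z) ->
  exists h, sdec h /\ beta_part h = la.
Proof.
move=> lag laM.
have lt i : (absz (la 0 i - i%:Z + W%:Z)%R < M)%N by have := laM i; lia.
exists [ffun i => Ordinal (lt i)]; split.
  apply/sdecP => i j ij; rewrite !ffunE /=.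
  by have := laM i; have := laM j; have := lag _ _ (ltnW ij); lia.
by apply/rowP => i; rewrite !mxE ffunE /=; have := laM i; lia.
Qed.

Lemma strip_beta_part b h f : sdec h -> sdec f ->
  strip b (beta_part h) (beta_part f) <->
  beta_strip b (fun i => h i : nat) (fun i => f i : nat).
Proof.
move=> hd fd; split=> [[H1 H2]|/beta_stripP[H1 H2]].
  apply/beta_stripP; split=> [i|i j bN ij].
    by have := H1 i; rewrite !mxE => -[? bP]; split=> [|/bP]; lia.
  by have := H2 _ _ bN ij; rewrite !mxE; lia.
split=> [i|i j bN ij].
  by have := H1 i; rewrite !mxE => -[? bP]; split=> [|/bP]; lia.
(* The condition for row [i.+1] implies the one for every later row, through the gaps of [h]. *)
have lt := leq_ltn_trans ij (ltn_ord j).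
have := H2 i (Ordinal lt) bN (leqnn _); have := sdec_gap hd (i := Ordinal lt) ij.
by rewrite !mxE /=; lia.
Qed.

End BetaNumbers.

(** * Generating functions of tableaux as minors *)

Section JacobiTrudi.
Variables (d : Order.disp_t) (C : orderType d) (C1 : {pred C}).
Variables (K : choiceType) (emb : C -> K).

(** The skew Schur polynomial in the even and odd letters of [L]. *)
Definition tabgf n (L : seq C) (la mu : 'rV[int]_n) : mseries K :=
  \sum_(T <- tabs C1 L la mu) mmono (fweight emb T).

Definition letter_mx M (a : C) : 'M[mseries K]_M :=
  \matrix_(p, q) letter_entry (a \in C1) (mmono [mset emb a]%mset) p q.

(** Later letters multiply on the left, since rows belong to the outer shape. The factors are lower
    triangular, so cutting them to size [M] does not change the entries of the product. *)
Definition transfer_mx M (L : seq C) : 'M[mseries K]_M :=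
  foldl (fun X a => letter_mx M a *m X) 1%:M L.

(** Removing [a] is a bijection onto pairs of an intermediate shape and a smaller tableau; the
    removed strip weighs one power of the variable per cell. *)
Lemma tabgf_rcons n M W (L : seq C) a (h g : {ffun 'I_n -> 'I_M}) :
  sdec h -> sdec g -> (forall b, b \in L -> (b < a)%O) ->
  tabgf (rcons L a) (beta_part W h) (beta_part W g) =
  \sum_(f : {ffun 'I_n -> 'I_M} | sdec f)
    (mmono [mset emb a]%mset ^+ (\sum_i (h i - f i)) *+
      beta_strip (a \in C1) (fun i => h i : nat) (fun i => f i : nat)) *
    tabgf L (beta_part W f) (beta_part W g).
Proof.
move=> hd gd La.
pose P (f : {ffun 'I_n -> 'I_M}) :=
  sdec f && beta_strip (a \in C1) (fun i => h i : nat) (fun i => f i : nat).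
pose s : seq {ffun 'I_n -> 'I_M} := filter P (index_enum _).
pose ext (f : {ffun 'I_n -> 'I_M}) T := add_strip a (beta_part W h) (beta_part W f) T.
have sP f : f \in s -> sdec f /\ strip (a \in C1) (beta_part W h) (beta_part W f).
  by rewrite mem_filter => /andP[/andP[fd fs] _]; split=> //;
    apply/(strip_beta_part W _ hd fd).
have perm : perm_eq (tabs C1 (rcons L a) (beta_part W h) (beta_part W g))
    [seq ext f T | f <- s, T <- tabs C1 L (beta_part W f) (beta_part W g)].
  apply: uniq_perm; first exact: fset_uniq.
    apply: allpairs_uniq_dep => [|f _|];
      rewrite ?fset_uniq ?filter_uniq ?index_enum_uniq//.
    move=> u v /allpairsPdep[f [T [fs tT ->]]] /allpairsPdep[f' [T' [fs' tT' ->]]] /= e.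
    have [[fd {}fs] [fd' {}fs']] := (sP _ fs, sP _ fs').
    move: tT tT' => /tabsP tT /tabsP tT'.
    have [/beta_part_inj ff TT] :=
      add_strip_inj La (strip_dincl fs) (strip_dincl fs') tT tT' e.
    by rewrite ff TT.
  move=> T; apply/idP/allpairsPdep => [/tabsP tT|].
    have [nu [S [nug st tS ->]]] :=
      tabl_remove_max (beta_part_gpart W hd) (beta_part_gpart W gd) La tT.
    (* [nu] lies between the inner and the outer shape, so its beta-numbers stay in the window. *)
    have [f [fd fE]] : exists f : {ffun 'I_n -> 'I_M}, sdec f /\ beta_part W f = nu.
      apply: beta_part_exists nug _ => i; have [_ /(_ i) + _] := tS.
      have := strip_dincl st i; rewrite !mxE.
      by have := ltn_ord (h i); lia.
    exists f, S; rewrite /ext fE; split=> //; last exact/tabsP.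
    rewrite mem_filter mem_index_enum /P fd andbT.
    by apply/(strip_beta_part W _ hd fd); rewrite fE.
  move=> [f [S [/sP[fd fs] /tabsP tS ->]]]; apply/tabsP.
  exact: add_strip_tabl (beta_part_gpart W fd) La fs tS.
rewrite /tabgf (perm_big _ perm) big_allpairs_dep big_filter /= big_mkcondr /=.
apply: eq_bigr => f fd; case: (boolP (beta_strip _ _ _)) => fs; last by rewrite mul0r.
rewrite big_distrr; apply: eq_big_seq => T /tabsP tT /=.
have st : strip (a \in C1) (beta_part W h) (beta_part W f).
  by apply/(strip_beta_part W _ hd fd).
rewrite fweight_cat => [|c]; last first.
  have [[dT _ _] _ _] := tT; rewrite dT in_skew_fset; last exact: strip_dincl st.
  by rewrite /skew_cell; lia.
rewrite mmonoD mulrC fweight_const mmono_msetn card_skew_fset.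
congr (_ ^+ _ * _); apply: eq_bigr => i _; rewrite !mxE.
by have := strip_dincl st i; rewrite !mxE; lia.
Qed.

Lemma tabgf_nil n M W (h g : {ffun 'I_n -> 'I_M}) :
  tabgf [::] (beta_part W h) (beta_part W g) = (h == g)%:R.
Proof.
rewrite /tabgf; case: eqP => [->|hg].
  rewrite (perm_big [:: [fmap]%fmap]) /=.
    rewrite big_seq1 -[RHS]/(mmono mset0); congr mmono.
    rewrite /fweight.
    have -> : [seq emb (([fmap]%fmap : filling n C) c) | c : domf [fmap]%fmap] = [::].
      by apply: size0nil; rewrite size_image -cardfE.
    by apply/msetP => x; rewrite mset_seqE mset0E.
  apply: uniq_perm; rewrite ?fset_uniq// => T; rewrite inE.
  by apply/idP/eqP => [/tabsP/tabl_nil[]|->] //; apply/tabsP/tabl_nil.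
by apply: big1_seq => T /andP[_ /tabsP/tabl_nil[/beta_part_inj]].
Qed.

(** The identity is the matrix of an odd letter whose variable is 0, so [det_letter] applies. *)
Lemma sdec_det_delta (R : comNzRingType) n M (h g : {ffun 'I_n -> 'I_M}) :
  sdec h -> sdec g -> \det (mxsub h g 1%:M) = (h == g)%:R :> R.
Proof.
move=> hd gd.
have -> : mxsub h g 1%:M =
    \matrix_(i, j) letter_entry true (0 : R) (h i) (g j).
  by apply/matrixP => i j; rewrite !mxE /letter_entry mul0rn addr0.
rewrite det_letter; [|exact/sdecP|exact/sdecP].
case: (h =P g) => [<-|hg].
  rewrite big1 => [|i _]; last by rewrite subnn.
  rewrite expr0; have -> // : beta_strip true (fun i => h i : nat) (fun i => h i : nat).
  by apply/beta_stripP; split.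
case: (boolP (beta_strip _ _ _)) => // /beta_stripP[hgs _].
rewrite expr0n; case: eqP => // /eqP; rewrite sum_nat_eq0 => /forallP hgi.
case: hg; apply/ffunP => i; apply: val_inj => /=.
by have := hgi i; have := hgs i; rewrite /=; lia.
Qed.

(** Both sides satisfy the same recursion in the last letter: the strip weights of [tabgf_rcons] are
    the one-letter minors of [det_letter]. *)
Lemma Jacobi_Trudi n M W (L : seq C) (h g : {ffun 'I_n -> 'I_M}) :
  sorted <%O L -> sdec h -> sdec g ->
  tabgf L (beta_part W h) (beta_part W g) = \det (mxsub h g (transfer_mx M L)).
Proof.
elim/last_ind: L => [|L a IH] in h g *.
  by move=> _ hd gd; rewrite tabgf_nil sdec_det_delta.
move=> Ls hd gd.
have La b : b \in L -> (b < a)%O.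
  by move: Ls; rewrite lt_sorted_pairwise pairwise_rcons => /andP[/allP + _]; apply.
rewrite tabgf_rcons// /transfer_mx foldl_rcons -/(transfer_mx M L).
rewrite det_mxsub_mul; apply: eq_bigr => f fd; congr (_ * _).
  rewrite -det_letter; [|exact/sdecP|exact/sdecP].
  by congr (\det _); apply/matrixP => i j; rewrite !mxE.
rewrite IH//.
by move: Ls; rewrite -cats1 => /cat_sorted2[].
Qed.

End JacobiTrudi.

(** * Rational tableaux *)

Section Truncation.
Variable K : choiceType.
Implicit Types (m : {mset K}%mset) (f g : mseries K).

(* Equality modulo the monomials that do not divide m0. *)
Definition eqm m0 f g := forall m, msubset m m0 -> f m = g m.

Lemma eqm_add m0 f f' g g' : eqm m0 f f' -> eqm m0 g g' -> eqm m0 (f + g) (f' + g').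
Proof. by move=> ff gg m mm; rewrite /GRing.add /= ff// gg. Qed.

(** Every factor of a divisor of [m0] divides [m0]. *)
Lemma eqm_mul m0 f f' g g' : eqm m0 f f' -> eqm m0 g g' -> eqm m0 (f * g) (f' * g').
Proof.
move=> ff gg m /msubsetP mm; rewrite /GRing.mul /= !mseries_mulE.
apply: eq_big_seq => -[p1 p2]; rewrite mem_splits /= => /eqP pm.
rewrite ff ?gg//; apply/msubsetP => x; apply: leq_trans (mm x);
  by rewrite -pm msetE2 ?leq_addr ?leq_addl.
Qed.

Lemma eqm_det m0 n (X Y : 'M[mseries K]_n) :
  (forall i j, eqm m0 (X i j) (Y i j)) -> eqm m0 (\det X) (\det Y).
Proof.
move=> XY; apply: big_ind2 => // [f f' g g'|s _]; first exact: eqm_add.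
apply: eqm_mul => //; apply: big_ind2 => // f f' g g'; exact: eqm_mul.
Qed.

Lemma mseries_sumE (I : Type) (r : seq I) (P : pred I) (F : I -> mseries K) m :
  (\sum_(i <- r | P i) F i) m = \sum_(i <- r | P i) F i m.
Proof. exact: (big_morph (fun f : mseries K => f m)). Qed.

Lemma msubset_size m1 m2 : msubset m1 m2 -> (size m1 <= size m2)%N.
Proof.
move=> /msubsetP m12; have [|s ss pms] := (count_subseqP m1 m2).1.
  by move=> x; rewrite !count_mem_mset.
by rewrite (perm_size pms); exact: size_subseq.
Qed.

End Truncation.

(** [get] selects the variables of one alphabet; sorting gives the increasing order in which letters
    are added. *)
Definition letters (K : choiceType) (d : Order.disp_t) (C : orderType d)
    (get : K -> option C) (m : {mset K}%mset) : seq C :=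
  sort <=%O (undup (pmap get m)).

Lemma letters_sorted (K : choiceType) d (C : orderType d) (get : K -> option C) m :
  sorted <%O (letters get m).
Proof. by rewrite sort_lt_sorted undup_uniq. Qed.

Lemma mem_letters (K : choiceType) d (C : orderType d) (get : K -> option C) m x a :
  x \in m -> get x = Some a -> a \in letters get m.
Proof.
by move=> xm xa; rewrite mem_sort mem_undup mem_pmap -xa; exact: map_f.
Qed.

(** * Horizontal translation of fillings *)

Section Translation.
Variables (n : nat) (d : nat).

Lemma placed_fnd (C : choiceType) (T P : filling n C) : placed d T P ->
  forall i j, T.[? (i, j)]%fmap = P.[? (i, j - d%:Z)]%fmap.
Proof. by move=> pl i j; rewrite pl. Qed.

Lemma placed_exists (C : choiceType) (P : filling n C) : exists T, placed d T P.
Proof.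
pose X : {fset cell n} :=
  [fset c in [seq ((c.1, (c.2 + d%:Z)%R) : cell n) | c <- domf P]]%fset.
exists (reducef [fmap c : X => P.[? ((val c).1, (val c).2 - d%:Z)]%fmap]%fmap).
move=> i j; rewrite fnd_reducef.
case: (boolP ((i, j) \in X)) => [ijX|ijX]; first by rewrite (in_fnd ijX) ffunE.
rewrite [X in ojoin X]not_fnd// not_fnd//; apply: contra ijX => ijP.
by rewrite inE; apply/mapP; exists (i, j - d%:Z) => //=; rewrite subrK.
Qed.

Lemma SST_placed (dC : Order.disp_t) (C : orderType dC) (C1 : {pred C})
    (la mu : 'rV[int]_n) (T P : filling n C) : placed d T P ->
  SST C1 (la + rect n d) (mu + rect n d) T <-> SST C1 la mu P.
Proof.
move=> pl; split=> -[dT rT cT]; split.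
- move=> [i j]; rewrite (placed_dom pl) dT /skew_cell /= !mxE.
  by rewrite lerD2r ltrD2r.
- move=> i j j' a a' jj'; rewrite -[j](addrK d%:Z) -[j'](addrK d%:Z) !pl.
  by apply: rT; rewrite ltrD2r.
- by move=> i i' j a a' ii'; rewrite -[j](addrK d%:Z) !pl; exact: cT.
- move=> [i j]; rewrite -fndSome (placed_fnd pl) fndSome dT /skew_cell /= !mxE.
  by rewrite lerBlDr ltrBrDr.
- move=> i j j' a a' jj'; rewrite !(placed_fnd pl).
  by apply: rT; rewrite ltrD2r.
- by move=> i i' j a a' ii'; rewrite !(placed_fnd pl); exact: cT.
Qed.

End Translation.

Section RationalTableaux.
Variables (dA dB : Order.disp_t) (A : orderType dA) (B : orderType dB).
Variables (A1 : {pred A}) (B1 : {pred B}).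

(** Measured from the vertical line, the inner shape is [mu - rect n d] and [d] disappears;
    conversely any large enough [d] gives back partitions. *)
Lemma rSSTP n (la : 'rV[int]_n) (P : filling n A * filling n B) : gpart la ->
  rSST A1 B1 la P <-> exists mu : 'rV[int]_n,
    [/\ gpart mu, dincl mu 0, dincl mu la, SST A1 la mu P.1 & SST B1 0 mu P.2].
Proof.
move=> lag; split.
  move=> [d [mu [Tp [Tm [[_ [mug _] mud mula] [sp sm plp plm]]]]]].
  exists (mu - rect n d); split.
  - by move=> i j ij; rewrite !mxE lerD2r; exact: mug.
  - by move=> i; have := mud i; rewrite !mxE subr_le0.
  - by move=> i; have := mula i; rewrite !mxE lerBlDr.
  - by apply/(SST_placed A1 _ _ plp); rewrite subrK.
  - by apply/(SST_placed B1 _ _ plm); rewrite subrK add0r.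
move=> [mu [mug mu0 mula sp sm]].
(* This makes [mu + rect n d] nonnegative, hence also [la + rect n d], as [mu] lies in [la]. *)
pose d := (\sum_i absz (mu 0%R i))%N.
have dmu i : - d%:Z <= mu 0 i.
  have : (absz (mu 0%R i) <= d)%N by rewrite /d (bigD1 i) //= leq_addr.
  by lia.
have [Tp plp] := placed_exists d P.1; have [Tm plm] := placed_exists d P.2.
exists d, (mu + rect n d), Tp, Tm; split; split=> //.
- split=> [i j ij|i]; first by rewrite !mxE lerD2r; exact: lag.
  by rewrite !mxE -lerBlDr sub0r; exact: le_trans (dmu i) (mula i).
- split=> [i j ij|i]; first by rewrite !mxE lerD2r; exact: mug.
  by rewrite !mxE -lerBlDr sub0r.
- by move=> i; have := mu0 i; rewrite !mxE gerDr.
- by move=> i; have := mula i; rewrite !mxE lerD2r.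
- exact/(SST_placed A1 _ _ plp).
- by have /(SST_placed B1 _ _ plm) := sm; rewrite add0r.
Qed.

Lemma weight_fweight n (P : filling n A * filling n B) :
  weight P = msetD (fweight inl P.1) (fweight inr P.2).
Proof. by apply/msetP => x; rewrite msetE2 !mset_seqE count_cat. Qed.

Let getA (x : A + B) := if x is inl a then Some a else None.
Let getB (x : A + B) := if x is inr b then Some b else None.

(** A tableau whose weight divides [m0] uses only letters of [m0] and has at most [size m0] cells in
    its [B]-part. This leaves finitely many inner shapes, all within the window. *)
Lemma rchar_trunc (m0 : {mset (A + B)%type}%mset) n M W (h h0 : {ffun 'I_n -> 'I_M}) :
  sdec h -> sdec h0 -> beta_part W h0 = 0 -> (size m0 + n <= W)%N ->
  eqm m0 (rchar A1 B1 (beta_part W h))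
    (\sum_(g : {ffun 'I_n -> 'I_M} | sdec g)
      tabgf A1 inl (letters getA m0) (beta_part W h) (beta_part W g) *
      tabgf B1 inr (letters getB m0) (beta_part W h0) (beta_part W g)).
Proof.
move=> hd h0d h0E leW m mm0.
set LA := letters _ _; set LB := letters _ _; set la := beta_part W h.
rewrite h0E.
pose prs (g : {ffun 'I_n -> 'I_M}) : seq (filling n A * filling n B) :=
  [seq (T, T') | T <- tabs A1 LA la (beta_part W g),
    T' <- tabs B1 LB 0 (beta_part W g)].
have prsP g P : P \in prs g <->
    tabl A1 LA la (beta_part W g) P.1 /\ tabl B1 LB 0 (beta_part W g) P.2.
  split=> [/allpairsP[[T T'] [/= /tabsP tT /tabsP tT' ->]] //|[tT tS]].
  by apply/allpairsP; exists P; split; [exact/tabsP|exact/tabsP|case: (P)].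
pose r := [seq P | g <- [seq g <- index_enum {ffun 'I_n -> 'I_M} | sdec g], P <- prs g].
have lag : gpart la by exact: beta_part_gpart.
have rP P : P \in r <-> exists2 g, sdec g & P \in prs g.
  split=> [/allpairsPdep[g [Q [+ Qg ->]]]|[g gd Pg]].
    by rewrite mem_filter => /andP[gd _]; exists g.
  by apply/allpairsPdep; exists g, P; rewrite mem_filter gd mem_index_enum.
have uniq_r : uniq r.
  apply: allpairs_uniq_dep => [|g _|]; first by rewrite filter_uniq// index_enum_uniq.
    by apply: allpairs_uniq => [||[T S] [T' S'] _ _ /= [-> ->]] //; exact: fset_uniq.
  move=> u v /allpairsPdep[g [P [_ Pg ->]]] /allpairsPdep[g' [P' [_ Pg' ->]]] /= PP.
  move: Pg Pg'; rewrite -PP => /prsP[tP _] /prsP[tP' _].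
  by have /beta_part_inj -> := tabl_mu_inj tP tP'.
have rS P : P \in r -> rSST A1 B1 la P.
  move=> /rP[g gd /prsP[[sT mula _] [sS mu0 _]]]; apply/(rSSTP _ lag).
  by exists (beta_part W g); split=> //; exact: beta_part_gpart.
rewrite /rchar (fsbigE r _ uniq_r) /=; first last.
(* Tableaux outside the list must not contribute: one of weight [m] would be in it. *)
- move=> P /(rSSTP _ lag)[mu [mug mu0 mula sp sm]] Pr.
  rewrite /mmono; case: eqP => // mP; case/negP: Pr; apply/rP.
  have wt x : x \in weight P -> x \in m0.
    by rewrite -mP => xm; exact: msubset_subset mm0 _ xm.
  (* The cell count gives [mu 0 i >= - size m0], hence the lower bound as [W >= size m0 + n]; the
     upper bound comes from [h0], as [mu] lies in 0. *)
  have [g [gd gE]] : exists g : {ffun 'I_n -> 'I_M}, sdec g /\ beta_part W g = mu.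
    apply: beta_part_exists mug _ => i.
    have := size_weight P; rewrite -mP => szm.
    have szd : #|` domf P.2| = (\sum_i absz (0%R - mu 0%R i)%R)%N.
      have -> : domf P.2 = skew_fset 0 mu.
        by apply/fsetP => c; rewrite in_skew_fset//; case: sm.
      by rewrite card_skew_fset; apply: eq_bigr => j _; rewrite mxE.
    have mi : (absz (0%R - mu 0%R i)%R <= size m0)%N.
      apply: leq_trans (msubset_size mm0); apply: leq_trans szm.
      by rewrite szd (bigD1 i) //= leq_addr.
    have := mu0 i; rewrite !mxE; have := ltn_ord i.
    have := congr1 (fun v : 'rV[int]_n => v 0 i) h0E; rewrite !mxE.
    by have := ltn_ord (h0 i); lia.
  exists g => //; apply/prsP; rewrite gE; split; split=> // c x.
    by move=> /weight_inl/wt/mem_letters; apply.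
  by move=> /weight_inr/wt/mem_letters; apply.
- by move=> P /= /rS.
rewrite big_mkcond /= (eq_big_seq (fun P => mmono (weight P) m)); last first.
  by move=> P /rS Pr; rewrite ifT//; exact/mem_set.
rewrite /r big_allpairs_dep big_filter mseries_sumE; apply: eq_bigr => g gd.
rewrite /prs big_allpairs /tabgf big_distrl mseries_sumE /=.
apply: eq_bigr => T _; rewrite big_distrr mseries_sumE /=.
by apply: eq_bigr => S _; rewrite weight_fweight mmonoD.
Qed.

(** The transpose makes the inner shape of the [B]-part a row index, so that Cauchy-Binet sums over
    the common [g]. The matrix product depends on neither [n] nor [W], which lets the case of level
    1 identify its entries. *)
Lemma rchar_det (m0 : {mset (A + B)%type}%mset) n M W (h h0 : {ffun 'I_n -> 'I_M}) :
  sdec h -> sdec h0 -> beta_part W h0 = 0 -> (size m0 + n <= W)%N ->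
  eqm m0 (rchar A1 B1 (beta_part W h))
    (\det (mxsub h h0 (transfer_mx A1 inl M (letters getA m0) *m
                       (transfer_mx B1 inr M (letters getB m0))^T))).
Proof.
move=> hd h0d h0E leW m mm0; rewrite (rchar_trunc hd h0d h0E leW mm0).
rewrite det_mxsub_mul; congr ((_ : mseries _) m); apply: eq_bigr => g gd.
rewrite (Jacobi_Trudi A1 inl W (letters_sorted _ _) hd gd).
rewrite (Jacobi_Trudi B1 inr W (letters_sorted _ _) h0d gd).
by rewrite -(det_tr (mxsub h0 g _)) trmx_mxsub.
Qed.

End RationalTableaux.

Unset Implicit Arguments.

Theorem theorem4p5 (dA dB : Order.disp_t) (A : orderType dA) (B : orderType dB)
    (A1 : {pred A}) (B1 : {pred B})
    (Acountable : countable [set: A]%classic)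
    (Bcountable : countable [set: B]%classic)
    (Ainfinite : infinite_set [set: A]%classic)
    (Binfinite : infinite_set [set: B]%classic)
    (n : nat) (la : 'rV[int]_n) (la_gpart : gpart la) :
  rchar A1 B1 la =
  \det (\matrix_(i < n, j < n)
          rchar A1 B1 (const_mx (la 0 i - i%:Z + j%:Z) : 'rV[int]_1)).
Proof.
apply/funext => m0.
(* [size m0 + n] is required by the truncation at [m0]; the sum keeps each [la 0 i - i + W] between
   0 and [2 * W]. *)
pose W := (size m0 + n + \sum_i absz (la 0%R i))%N.
have laW i : (absz (la 0%R i) + (size m0 + n) <= W)%N.
  by rewrite /W addnC leq_add2l (bigD1 i) //= leq_addr.
have leW : (size m0 + n <= W)%N by rewrite leq_addr.
pose M := (2 * W).+1.
have [h [hd hE]] : exists h : {ffun 'I_n -> 'I_M}, sdec h /\ beta_part W h = la.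
  apply: beta_part_exists la_gpart _ => i.
  by have := laW i; have := ltn_ord i; rewrite /M; lia.
have [h0 [h0d h0E]] : exists h : {ffun 'I_n -> 'I_M}, sdec h /\ beta_part W h = 0.
  apply: beta_part_exists => [i j _|i]; first by rewrite !mxE.
  by rewrite mxE; have := ltn_ord i; rewrite /M; lia.
have m00 : msubset m0 m0 by exact: msubset_refl.
rewrite -{1}hE (rchar_det A1 B1 hd h0d h0E leW m00).
(* The coefficient at [m0] of a determinant depends on its entries only modulo [eqm m0]. *)
apply/esym/(eqm_det _ m00) => i k; rewrite !mxE.
have hi := congr1 (fun v : 'rV[int]_n => v 0 i) hE.
have h0k := congr1 (fun v : 'rV[int]_n => v 0 k) h0E.
move: hi h0k; rewrite !mxE => hi h0k; have ltk := ltn_ord k.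
pose c (p : 'I_M) : {ffun 'I_1 -> 'I_M} := [ffun=> p].
have cd p : sdec (c p) by apply/sdecP => u v; rewrite !ord1 ltnn.
(* Shifting the origin by k makes h i and h0 k the beta-numbers of
   la_i - i + k and 0 in level 1. *)
have cE : beta_part (W - k) (c (h i)) = const_mx (la 0 i - i%:Z + k%:Z).
  by apply/rowP => u; rewrite ord1 !mxE ffunE /=; lia.
have c0E : beta_part (W - k) (c (h0 k)) = 0.
  by apply/rowP => u; rewrite ord1 !mxE ffunE /=; lia.
rewrite -cE => m mm0.
rewrite (rchar_det A1 B1 (cd _) (cd _) c0E _ mm0); last first.
  (* As [k < n], the bound [size m0 + n <= W] leaves [size m0 + 1 <= W - k]. *)
  by apply: leq_trans (leq_sub2r k leW); rewrite -addnBA ?leq_add2l ?subn_gt0 // ltnW.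
by rewrite det_mx11 !mxE !ffunE.
Qed.
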